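(* Let $\alpha=(\alpha_n)_{n\ge1}$ be a probability measure on the set of positive integers, let $\lambda=\sum_{n\ge1}\alpha_n\kappa_n$ with $\kappa_n=\mathrm{Unif}(K_n)$, and let $\mu=\delta_{-1}\otimes\lambda$ be the corresponding probability measure on the lamplighter group $\mathcal L=\mathbb Z\wr\mathbb Z_2$. Then $\mu$ is Liouville if and only if the entropy $H(\mu)$ is infinite.
   Context: Random walks and the Liouville property. For a probability measure $\mu$ on a countable group $G$ (with identity $e$), the random walk $(G,\mu)$ issued from $e$ is $g_t=h_1h_2\cdots h_t$, $g_0=e$, with $(h_t)$ i.i.d. $\mu$-distributed; let $\mathbf P$ be its law on $G^{\mathbb Z_+}$. The measure $\mu$ is called Liouville if the image of $\mathbf P$ on the Poisson boundary is a point mass, i.e. if every subset of $G^{\mathbb Z_+}$ invariant under the time shift $(g_0,g_1,\dots)\mapsto(g_1,g_2,\dots)$ has $\mathbf P$-measure $0$ or $1$. Equivalently, every bounded function $f$ on the set $S=\bigcup_{t\ge0}\operatorname{supp}\mu^{*t}$ of points attainable from $e$ (with $\mu^{*0}=\delta_e$) satisfying $f(g)=\sum_h\mu(h)f(gh)$ for all $g\in S$ is constant. No irreducibility of $\mu$ is assumed. The entropy is $H(\mu)=-\sum_g\mu(g)\log\mu(g)\in[0,\infty]$. Group. $\Phi=\bigoplus_{\mathbb Z}\mathbb Z_2$ is the group of finitely supported functions (configurations) $\varphi:\mathbb Z\to\mathbb Z_2=\{0,1\}$ under pointwise addition mod 2, with $\operatorname{supp}\varphi=\varphi^{-1}(1)$.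 The shifts are $(T^n\varphi)(z)=\varphi(z-n)$. The lamplighter group $\mathcal L=\mathbb Z\wr\mathbb Z_2$ is the set $\mathbb Z\times\Phi$ with multiplication $(n_1,\varphi_1)(n_2,\varphi_2)=(n_1+n_2,\varphi_1+T^{n_1}\varphi_2)$. Measures. For $n\ge1$, $K_n=\{\varphi\in\Phi:\operatorname{supp}\varphi\subset\{0,1,\dots,n\},\ \varphi(n)=1\}$ (so $|K_n|=2^n$), and $\kappa_n=\mathrm{Unif}(K_n)$ is the uniform probability measure on $K_n$. The measure $\delta_{-1}\otimes\lambda$ on $\mathcal L=\mathbb Z\times\Phi$ assigns mass $\lambda(\varphi)$ to $(-1,\varphi)$. *)

(* Defs.v *)
From HB Require Import structures.
From mathcomp Require Import all_boot all_order all_algebra.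
From mathcomp Require Import finmap.
From mathcomp Require Import all_classical all_reals all_analysis.

Set Implicit Arguments.
Unset Strict Implicit.
Unset Printing Implicit Defensive.

Import Order.TTheory GRing.Theory Num.Theory.

Local Open Scope classical_set_scope.
Local Open Scope ring_scope.

(* Probability measures on countable (discrete) sets are represented by their
   mass functions. *)

Section Entropy.
Variables (R : realType) (T : choiceType).

(* The terms are nonnegative for a probability mass function, so the unordered
   sum is the entropy in [0, +oo]; [ln 0 = 0], whence 0 log 0 = 0. *)
Definition entropy (p : T -> R) : \bar R :=
  \esum_(x in [set: T]) (- (p x * ln (p x)))%:E.

(* Meaningful for finite nonempty A only. *)
Definition unif (A : set T) (x : T) : R :=
  \1_A x / (#|` fset_set A|)%:R.

End Entropy.

Section RandomWalk.

Definition sequences (G : groupType) : Type := nat -> G.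

HB.instance Definition _ (G : groupType) := Choice.on (sequences G).
HB.instance Definition _ (G : groupType) :=
  isPointed.Build (sequences G) (fun=> 1%g).

Definition cylinders (G : groupType) : set (set (sequences G)) :=
  [set C | exists (t : nat) (x : G), C = [set w | w t = x]].

(* For countable G this is the product sigma-algebra on G^{Z_+} of the discrete
   sigma-algebras on the factors. *)
Definition seq_space (G : groupType) := g_sigma_algebraType (@cylinders G).

(* The coordinates are independent with common mass function mu. *)
Definition iid_law (R : realType) (G : groupType) (mu : G -> R)
    (Q : probability (seq_space G) R) : Prop :=
  forall (n : nat) (x : nat -> G),
    Q [set h : seq_space G | forall t, (t < n)%N -> h t = x t]
    = (\prod_(t < n) mu (x t))%:E.

(* The increment h_t of the walk is [h t.-1]. *)
Fixpoint walk_at (G : groupType) (h : nat -> G) (t : nat) : G :=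
  if t is s.+1 then (walk_at h s * h s)%g else 1%g.

Definition walk (G : groupType) (h : seq_space G) : seq_space G := walk_at h.

Definition time_shift (G : groupType) (w : seq_space G) : seq_space G :=
  fun t => w t.+1.

(* For a probability mu on a countable G, Q exists and is unique by Kolmogorov's extension
   theorem, and [pushforward Q walk] is the law of the random walk on the path
   space. *)
Definition liouville (R : realType) (G : groupType) (mu : G -> R) : Prop :=
  forall Q : probability (seq_space G) R, iid_law mu Q ->
  forall A : set (seq_space G), measurable A ->
    @time_shift G @^-1` A = A ->
    pushforward Q (@walk G) A = 0%E \/ pushforward Q (@walk G) A = 1%E.

End RandomWalk.

Definition config : Type := {fsfun int -> 'F_2 with 0}.

HB.instance Definition _ := Countable.on config.

Section Configurations.
Definition config0 : config := [fsfun].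
Definition config_add (phi psi : config) : config :=
  [fsfun z in (finsupp phi `|` finsupp psi)%fset => phi z + psi z].
Definition config_opp (phi : config) : config :=
  [fsfun z in finsupp phi => - phi z].
Definition config_shift (n : int) (phi : config) : config :=
  [fsfun z in [fset (y + n)%R | y in finsupp phi]%fset => phi (z - n)].

Lemma configP (phi psi : config) : (forall z, phi z = psi z) -> phi = psi.
Proof. by move=> e; apply/fsfunP. Qed.

Lemma config_out (phi : config) z : z \notin finsupp phi -> phi z = 0.
Proof. exact: fsfun_dflt. Qed.

Lemma config0E z : config0 z = 0.
Proof. exact: fsfun0E. Qed.

Lemma config_addE phi psi z : config_add phi psi z = phi z + psi z.
Proof.
rewrite fsfunE; case: ifPn => //.
by rewrite inE negb_or => /andP[/config_out -> /config_out ->]; rewrite addr0.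
Qed.

Lemma config_oppE phi z : config_opp phi z = - phi z.
Proof.
by rewrite fsfunE; case: ifPn => // /config_out ->; rewrite oppr0.
Qed.

Lemma config_shiftE n phi z : config_shift n phi z = phi (z - n).
Proof.
rewrite fsfunE; case: ifPn => // zn; rewrite config_out//.
apply: contra zn => zn; apply/imfsetP; exists (z - n) => //=.
by rewrite subrK.
Qed.

Fact config_addA : associative config_add.
Proof. by move=> a b c; apply: configP => z; rewrite !config_addE addrA. Qed.
Fact config_addC : commutative config_add.
Proof. by move=> a b; apply: configP => z; rewrite !config_addE addrC. Qed.
Fact config_add0 : left_id config0 config_add.
Proof. by move=> a; apply: configP => z; rewrite config_addE config0E add0r. Qed.
Fact config_addN : left_inverse config0 config_opp config_add.
Proof.
by move=> a; apply: configP => z; rewrite config_addE config_oppE config0E addNr.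
Qed.

End Configurations.

HB.instance Definition _ := GRing.isZmodule.Build config
  config_addA config_addC config_add0 config_addN.

Definition lamplighter : Type := (int * config)%type.

HB.instance Definition _ := Countable.on lamplighter.

Section LamplighterGroup.

Definition ll_one : lamplighter := (0, 0).
Definition ll_mul (g h : lamplighter) : lamplighter :=
  (g.1 + h.1, g.2 + config_shift g.1 h.2).
Definition ll_inv (g : lamplighter) : lamplighter :=
  (- g.1, - config_shift (- g.1) g.2).

Let addE (a b : config) z : (a + b) z = a z + b z.
Proof. exact: config_addE. Qed.
Let oppE (a : config) z : (- a) z = - a z.
Proof. exact: config_oppE. Qed.
Let zeroE z : (0 : config) z = 0.
Proof. exact: config0E. Qed.
Let llE := (addE, oppE, zeroE, config_shiftE).

Fact ll_mulA : associative ll_mul.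
Proof.
move=> [m a] [n b] [k c]; rewrite /ll_mul/=; congr pair; first exact: addrA.
by apply: configP => z; rewrite !llE addrA opprD [in RHS]addrA.
Qed.
Fact ll_mul1g : left_id ll_one ll_mul.
Proof.
move=> [m a]; rewrite /ll_mul/=; congr pair; first exact: add0r.
by apply: configP => z; rewrite !llE add0r subr0.
Qed.
Fact ll_mulg1 : right_id ll_one ll_mul.
Proof.
move=> [m a]; rewrite /ll_mul/=; congr pair; first exact: addr0.
by apply: configP => z; rewrite !llE addr0.
Qed.
Fact ll_mulVg : left_inverse ll_one ll_inv ll_mul.
Proof.
move=> [m a]; rewrite /ll_mul/=; congr pair; first exact: addNr.
by apply: configP => z; rewrite !llE addNr.
Qed.
Fact ll_mulgV : right_inverse ll_one ll_inv ll_mul.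
Proof.
move=> [m a]; rewrite /ll_mul/=; congr pair; first exact: addrN.
by apply: configP => z; rewrite !llE opprK subrK addrN.
Qed.

End LamplighterGroup.

HB.instance Definition _ := isGroup.Build lamplighter
  ll_mulA ll_mul1g ll_mulg1 ll_mulVg ll_mulgV.

Section Measures.
Variable R : realType.

Definition K (n : nat) : set config :=
  [set phi | (forall z : int, phi z = 1 -> 0 <= z <= n%:Z) /\ phi n%:Z = 1].

Definition kappa (n : nat) : config -> R := unif R (K n).

(* The series is bounded by 1 when alpha is a probability. *)
Definition lambda (alpha : nat -> R) (phi : config) : R :=
  fine (\sum_(1 <= n <oo) (alpha n * kappa n phi)%:E)%E.

(* delta_{-1} (x) lambda *)
Definition mu (alpha : nat -> R) (g : lamplighter) : R :=
  (g.1 == -1)%:R * lambda alpha g.2.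

End Measures.

(* Main.v *)
From HB Require Import structures.
Require Import Defs.
From mathcomp Require Import all_boot all_order all_algebra.
From mathcomp Require Import finmap.
From mathcomp Require Import all_classical all_reals all_analysis.
From mathcomp Require Import ring lra zify.

(** Both sides are equivalent to the divergence of the mean length
    Sum n alpha_n.

    Entropy. On the 2^n elements of {-1} x K_n the mass of mu is
    p = alpha_n / 2^n, so they contribute n alpha_n ln 2 - alpha_n ln alpha_n.
    The last term is nonnegative, and at most n alpha_n ln 2 + 2^-n; hence
    entropy and mean length are finite together ([entropy_infinite_mean]).

    Divergent mean implies a zero-one law. At time t the walk stands at -t, all
    lamps left of -t are still off, and an increment of length n makes the
    lamps from -t to n - t - 1 uniform. The mean being infinite, for every c
    there are almost surely increments of length at least c + t at some time t
    (second Borel-Cantelli lemma, [iid_hit_ae]). Given two words of increments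
    of the same size, their endpoints differ by a finite configuration; adding
    this configuration to the first increment that is long enough to cover it
    preserves the law of the increments ([modify_preserving]) and makes the two
    trajectories coincide from then on ([walk_superpose]). So the probability
    of an invariant event is the same after every word of a given size
    ([equal_futures]): the event is independent of all finite prefixes, hence
    of itself ([zero_one_futures]).

    Finite mean implies non-trivial invariant events. Now only finitely many
    increments reach the origin (first Borel-Cantelli lemma), so the lamp at 0
    almost surely settles to a limit value ([lamp_settles_ae]). Toggling this
    lamp in the first increment preserves the law and exchanges the two values
    ([lamp_settles_flip]), so each has probability 1/2. Here a law of the
    increments is needed to begin with; it is the image of Lebesgue measure on
    [0, 1[ under an expansion adapted to mu ([iid_law_exists]). *)

Set Implicit Arguments.
Unset Strict Implicit.
Unset Printing Implicit Defensive.
Import Order.TTheory GRing.Theory Num.Theory.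
Local Open Scope classical_set_scope.
Local Open Scope ring_scope.

(** * Measures on sequences over a countable group *)

#[short(type="countGroupType")]
HB.structure Definition CountGroup := {G of Group G & Countable G}.

HB.instance Definition _ := Countable.on lamplighter.

Section CountableAdditivity.
Context d (T : measurableType d) (R : realType) (P : {measure set T -> \bar R}).

Lemma bigcup_countType_measurable (I : countType) (D : set I) (F : I -> set T) :
  (forall i, D i -> measurable (F i)) -> measurable (\bigcup_(i in D) F i).
Proof.
move=> mF; rewrite bigcup_mkcond; apply: countable_bigcupT_measurable.
  by [].
by move=> i; case: ifPn => // /set_mem; exact: mF.
Qed.

Lemma measure_bigcup_countType (I : countType) (D : set I) (F : I -> set T) :
  (forall i, D i -> measurable (F i)) -> trivIset D F ->
  P (\bigcup_(i in D) F i) = \esum_(i in D) P (F i).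
Proof.
move=> mF tF.
pose F' n := if choice.unpickle n is Some i then F i else set0.
have F'E i : F' (choice.pickle i) = F i by rewrite /F' choice.pickleK.
rewrite (_ : \bigcup_(i in D) F i = \bigcup_(n in choice.pickle @` D) F' n).
  rewrite measure_bigcup/=.
  - rewrite nneseries_esum// set_mem_set (reindex_esum D _ choice.pickle).
      by apply: eq_esum => i _; rewrite F'E.
    by apply: inj_bij => i j _ _; exact: (pcan_inj choice.pickleK).
  - by move=> _ [i Di <-]; rewrite F'E; exact: mF.
  - move=> _ _ [i Di <-] [j Dj <-]; rewrite !F'E => /tF.
    by move=> /(_ Di Dj) ->.
by rewrite bigcup_image; apply: eq_bigcupr => i _; rewrite F'E.
Qed.

End CountableAdditivity.

Lemma esumZl (R : realType) (I : choiceType) (D : set I) (r : R)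
    (a : I -> \bar R) : 0 <= r -> (forall i, D i -> (0 <= a i)%E) ->
  (\esum_(i in D) (r%:E * a i) = r%:E * \esum_(i in D) a i)%E.
Proof.
move=> r0 a0; rewrite /esum -ereal_supZl//; last first.
  by apply/set0P; eexists; exists set0; first exact: fsets_set0.
congr ereal_sup; rewrite image_comp; apply: eq_imagel => X [_ XD] /=.
rewrite fsbig_mkcond [in RHS]fsbig_mkcond ge0_mule_fsumr.
  by apply: eq_fsbigr => i _; rewrite /patch; case: ifPn; rewrite ?mule0.
by move=> i; rewrite /patch; case: ifPn => // /set_mem/XD/a0.
Qed.

Lemma esum_cst (R : realType) (T : choiceType) (D : set T) (c : R) :
  finite_set D -> 0 <= c ->
  (\esum_(x in D) c%:E = (#|` fset_set D|%:R * c)%:E)%E.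
Proof.
move=> finD c0; rewrite esum_fset// fsbig_finite//= sumEFin big_const_seq.
by rewrite count_predT iter_addr_0 mulr_natl.
Qed.

Lemma measure_eq_off_null d (T : measurableType d) (R : realType)
    (P : {measure set T -> \bar R}) (N X Y : set T) :
  measurable N -> measurable X -> measurable Y -> P N = 0%E ->
  (forall x, ~ N x -> X x <-> Y x) -> P X = P Y.
Proof.
move=> mN mX mY N0 XY.
have le X' Y' : measurable X' -> measurable Y' ->
    (forall x, ~ N x -> X' x -> Y' x) -> (P X' <= P Y')%E.
  move=> mX' mY' sub; apply: (@le_trans _ _ (P (Y' `|` N))).
    apply: le_measure; rewrite ?inE//; first exact: measurableU.
    by move=> x X'x; have [Nx|Nx] := pselect (N x); [right|left; exact: sub].
  by apply: (le_trans (measureU2 _ mY' mN)); rewrite [X in (_ + X)%E]N0 adde0.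
by apply/eqP; rewrite eq_le; apply/andP; split; apply: le => // x /XY[].
Qed.

Section Words.
Variable G : countGroupType.
Implicit Types (h : seq_space G) (s : seq G) (E : set (seq_space G)).

(** Words are used rather than functions on an initial segment because they
    form a countable type: unions over all words are measurable, and sums over
    all words compute measures. *)
Definition cyl s : set (seq_space G) := [set h | mkseq h (size s) = s].

Lemma cylP s h : cyl s h <-> forall t, (t < size s)%N -> h t = nth 1%g s t.
Proof.
split=> [e t ts|e]; first by rewrite -[in RHS]e nth_mkseq.
apply: (@eq_from_nth _ 1%g); rewrite size_mkseq// => t ts.
by rewrite nth_mkseq// e.
Qed.

Lemma cyl_meet_cat s s' : (size s <= size s')%N ->
  cyl s' `&` cyl s !=set0 -> exists u, s' = s ++ u.
Proof.
move=> ss' [h [h1 h2]]; exists (drop (size s) s').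
rewrite -{1}(cat_take_drop (size s) s'); congr (_ ++ _).
rewrite -h1 -[in RHS]h2; apply: (@eq_from_nth _ 1%g).
  by rewrite size_takel ?size_mkseq.
rewrite size_takel ?size_mkseq// => t ts.
by rewrite nth_take// !nth_mkseq// (leq_trans ts).
Qed.

Lemma sub_cyl_cat s u : cyl (s ++ u) `<=` cyl s.
Proof.
move=> h /cylP hsu; apply/cylP => t ts.
by rewrite hsu ?size_cat ?ltn_addr// nth_cat ts.
Qed.

Lemma measurable_coordinate t (x : G) :
  measurable [set h : seq_space G | h t = x].
Proof. by apply: sub_sigma_algebra; exists t, x. Qed.

Lemma measurable_cyl s : measurable (cyl s).
Proof.
rewrite (_ : cyl s = \bigcap_(t in [set t | (t < size s)%N])
    [set h : seq_space G | h t = nth 1%g s t]); last first.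
  by apply/seteqP; split=> h /= /cylP.
apply: fin_bigcap_measurable => [|t _]; last exact: measurable_coordinate.
exact: finite_II.
Qed.

Definition depends_on_first n E :=
  forall h h', mkseq h n = mkseq h' n -> E h -> E h'.

Lemma depends_on_first_cyl n E : depends_on_first n E ->
  E = \bigcup_(s in [set s | size s = n /\ E (nth 1%g s)]) cyl s.
Proof.
move=> En; apply/seteqP; split=> [h Eh|h [s [ns Es] hs]].
  exists (mkseq h n); last by rewrite /cyl/= size_mkseq.
  split; first by rewrite size_mkseq.
  apply: En Eh; apply: (@eq_from_nth _ 1%g); rewrite !size_mkseq// => t tn.
  by rewrite !nth_mkseq.
apply: En Es; rewrite -ns hs; apply: (@eq_from_nth _ 1%g).
  by rewrite size_mkseq.
by rewrite size_mkseq => t ts; rewrite nth_mkseq.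
Qed.

Lemma depends_on_first_measurable n E : depends_on_first n E -> measurable E.
Proof.
move=> /depends_on_first_cyl ->; apply: bigcup_countType_measurable => s _.
exact: measurable_cyl.
Qed.

Lemma coordinatewise_measurable d (T : measurableType d) (F : T -> seq_space G) :
  (forall t x, measurable [set h | F h t = x]) -> measurable_fun setT F.
Proof.
move=> mF; apply: (@measurability _ _ T (seq_space G) setT F (@cylinders G) erefl).
move=> _ [_ [t [x ->]] <-]; rewrite setTI; exact: mF.
Qed.

Lemma adapted_measurable (F : seq_space G -> seq_space G) :
  (forall t, exists n, forall h h', mkseq h n = mkseq h' n -> F h t = F h' t) ->
  measurable_fun setT F.
Proof.
move=> adF; apply: coordinatewise_measurable => t x.
have [n Fn] := adF t; apply: (@depends_on_first_measurable n) => h h' e /= <-.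
by rewrite (Fn _ _ e).
Qed.

Lemma trivIset_cyl n : trivIset [set s | size s = n] cyl.
Proof.
by move=> s s' sn s'n [h [/= <- ]]; rewrite sn -s'n => ->.
Qed.

Lemma bigcup_cyl n : \bigcup_(s in [set s | size s = n]) cyl s = setT.
Proof.
apply/seteqP; split=> // h _; exists (mkseq h n); rewrite /cyl /= ?size_mkseq//.
Qed.

Variable R : realType.

Lemma measure_partition_cyl (P : {measure set (seq_space G) -> \bar R}) n E :
  measurable E ->
  P E = \esum_(s in [set s | size s = n]) P (E `&` cyl s).
Proof.
move=> mE; rewrite -[in LHS](setIT E) -(bigcup_cyl n) setI_bigcupr.
rewrite measure_bigcup_countType// => [s _|].
  by apply: measurableI => //; exact: measurable_cyl.
by apply: trivIset_setIl; exact: trivIset_cyl.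
Qed.

(** Two cylinders are nested or disjoint, so together with the empty set they
    are closed under intersection, and they generate the sigma-algebra. *)
Lemma measure_eq_cyl (P P' : {measure set (seq_space G) -> \bar R}) :
  (P setT < +oo)%E -> (forall s, P (cyl s) = P' (cyl s)) ->
  forall E, measurable E -> P E = P' E.
Proof.
move=> Pfin PP' E mE.
pose C := [set E : set (seq_space G) | E = set0 \/ exists s, E = cyl s].
have cyl0 : cyl [::] = setT by apply/seteqP.
apply: (measure_unique C (fun=> setT)) => //.
- apply/seteqP; split; last first.
    apply: smallest_sub; first exact: sigma_algebra_measurable.
    by move=> _ [->|[s ->]]; [exact: measurable0|exact: measurable_cyl].
  apply: smallest_sub; first exact: smallest_sigma_algebra.
  pose CT := g_sigma_algebraType C.
  move=> _ [t [x ->]].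
  (* a coordinate event is a countable union of cylinders *)
  rewrite (@depends_on_first_cyl t.+1 [set h | h t = x]); last first.
    move=> h h' /(congr1 (fun s => nth 1%g s t)).
    by rewrite !nth_mkseq// => e /=; rewrite e.
  apply: (@bigcup_countType_measurable _ CT) => s _.
  by apply: sub_sigma_algebra; right; exists s.
- have cylI s s' : (size s <= size s')%N -> C (cyl s' `&` cyl s).
    move=> ss'; have [->|/set0P ne] := eqVneq (cyl s' `&` cyl s) set0.
      by left.
    right; exists s'; apply: setIidl; have [u ->] := cyl_meet_cat ss' ne.
    exact: sub_cyl_cat.
  move=> _ _ [->|[s ->]] [->|[s' ->]]; rewrite ?set0I ?setI0; try by left.
  have [ss'|/ltnW ss'] := leqP (size s) (size s'); last exact: cylI.
  by rewrite setIC; exact: cylI.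
- by move=> _; right; exists [::]; rewrite cyl0.
- by apply/seteqP; split=> // h _; exists 0%N.
- by move=> _ [->|[s ->]]; rewrite ?measure0// PP'.
Qed.

End Words.

Section Prepend.
Variable G : countGroupType.
Implicit Types (h : seq_space G) (s : seq G) (E : set (seq_space G)).

Definition prepend s h : seq_space G :=
  fun t => if (t < size s)%N then nth 1%g s t else h (t - size s)%N.

Lemma mkseq_prependl s h n : (n <= size s)%N ->
  mkseq (prepend s h) n = take n s.
Proof.
move=> ns; apply: (@eq_from_nth _ 1%g); rewrite size_mkseq ?size_takel// => t tn.
by rewrite nth_mkseq// nth_take// /prepend (leq_trans tn).
Qed.

Lemma mkseq_prependr s h n :
  mkseq (prepend s h) (size s + n) = s ++ mkseq h n.
Proof.
apply: (@eq_from_nth _ 1%g); rewrite ?size_cat !size_mkseq// => t tn.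
rewrite nth_mkseq// nth_cat /prepend; case: ltnP => // st.
by rewrite nth_mkseq// ltn_subLR.
Qed.

Lemma cyl_prepend s h : cyl s (prepend s h).
Proof. by rewrite /cyl/= mkseq_prependl// take_size. Qed.

Lemma prepend_measurable s : measurable_fun setT (prepend s).
Proof.
apply: adapted_measurable => t; exists t.+1 => h h'.
rewrite /prepend; case: ltnP => // _ /(congr1 (nth 1%g ^~ (t - size s)%N)).
by rewrite !nth_mkseq ?ltnS ?leq_subr.
Qed.

End Prepend.

(** * Independent identically distributed increments *)

Section IID.
Variables (G : countGroupType) (R : realType) (m : G -> R).
Variable Q : probability (seq_space G) R.
Hypothesis Qm : iid_law m Q.
Implicit Types (h : seq_space G) (s : seq G) (E : set (seq_space G)).

Lemma iid_cyl s : Q (cyl s) = (\prod_(x <- s) m x)%:E.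
Proof.
rewrite (_ : cyl s = [set h | forall t, (t < size s)%N -> h t = nth 1%g s t]).
  by rewrite Qm (big_nth 1%g) big_mkord.
by apply/seteqP; split=> h /cylP.
Qed.

Lemma iid_ge0 x : 0 <= m x.
Proof.
have : (0 <= (\prod_(y <- [:: x]) m y)%:E)%E by rewrite -iid_cyl.
by rewrite big_seq1.
Qed.

Lemma iid_prod_ge0 s : 0 <= \prod_(x <- s) m x.
Proof. by apply: prodr_ge0 => x _; exact: iid_ge0. Qed.

(** The Markov property: conditionally on its first letters, the sequence is
    a fixed word followed by a fresh copy of itself. It suffices to compare
    both sides, as measures in [E], on cylinders. *)
Lemma iid_markov s E : measurable E ->
  Q (E `&` cyl s) = ((\prod_(x <- s) m x)%:E * Q (prepend s @^-1` E))%E.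
Proof.
have mp := @prepend_measurable G s.
pose P1 : {measure set _ -> \bar R} := mrestr Q (@measurable_cyl G s).
pose P2 : {measure set _ -> \bar R} :=
  mscale (NngNum (iid_prod_ge0 s)) (distribution Q (mfun_Sub (mem_set mp))).
apply: (@measure_eq_cyl _ _ P1 P2); rewrite /P1 /P2.
  by rewrite /= /mrestr setTI iid_cyl ltry.
move=> s'; rewrite /= /mrestr /mscale/= /distribution/= /pushforward/=.
have [e|/set0P ne] := eqVneq (cyl s' `&` cyl s) set0.
  rewrite e measure0 (_ : _ @^-1` _ = set0) ?measure0 ?mule0//.
  apply/seteqP; split=> // h hs'.
  have : (cyl s' `&` cyl s) (prepend s h) by split=> //; exact: cyl_prepend.
  by rewrite e.
have [ss'|/ltnW s's] := leqP (size s) (size s').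
- have [u ->] := cyl_meet_cat ss' ne.
  rewrite setIidl; last exact: sub_cyl_cat.
  rewrite (_ : _ @^-1` _ = cyl u).
    by rewrite !iid_cyl big_cat EFinM.
  apply/seteqP; split=> h; rewrite /cyl/= size_cat mkseq_prependr.
    by move/eqP; rewrite eqseq_cat// eqxx => /eqP.
  by move=> ->.
- rewrite setIC in ne *; have [u us] := cyl_meet_cat s's ne.
  rewrite setIidl; last by rewrite us; exact: sub_cyl_cat.
  rewrite (_ : _ @^-1` _ = setT) ?probability_setT ?mule1 ?iid_cyl//.
  apply/seteqP; split=> h // _.
  by rewrite /cyl/= mkseq_prependl// us take_size_cat.
Qed.

Lemma iid_coordinate (B : set G) :
  Q [set h | B (h 0%N)] = (\esum_(x in B) (m x)%:E)%E.
Proof.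
rewrite (_ : [set h | B (h 0%N)] = \bigcup_(x in B) cyl [:: x]).
  rewrite measure_bigcup_countType.
  - by apply: eq_esum => x _; rewrite [LHS]iid_cyl big_seq1.
  - by move=> x _; exact: measurable_cyl.
  - by move=> x y _ _ [h [/= [<-] [<-]]].
by apply/seteqP; split=> h /=; [move=> Bh; exists (h 0%N) | move=> [x Bx [->]]].
Qed.

Lemma measurable_coordinate_set t (B : set G) :
  measurable [set h : seq_space G | B (h t)].
Proof.
apply: (@depends_on_first_measurable _ t.+1) => h h'.
move=> /(congr1 (nth 1%g ^~ t)); rewrite !nth_mkseq// => e /=.
by rewrite e.
Qed.

Lemma iid_independent n E (B : set G) : depends_on_first n E ->
  Q (E `&` [set h | B (h n)]) = (Q E * \esum_(x in B) (m x)%:E)%E.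
Proof.
move=> nE; have mE := depends_on_first_measurable nE.
have mB t := @measurable_coordinate_set t B.
have fB : Q [set h | B (h 0%N)] \is a fin_num by exact: fin_num_measure.
rewrite -iid_coordinate -(fineK fB) muleC.
rewrite [Q E](measure_partition_cyl Q n)// -esumZl; last first.
- by move=> s _; exact: measure_ge0.
- by apply: fine_ge0; exact: measure_ge0.
rewrite (measure_partition_cyl Q n); last exact: measurableI.
apply: eq_esum => s sn.
rewrite [LHS]iid_markov; last exact: measurableI.
rewrite [X in (_ = _ * X)%E]iid_markov//.
rewrite fineK// muleCA; congr (_ * _)%E.
have pE h h' : E (prepend s h) -> E (prepend s h').
  by apply: nE; rewrite !mkseq_prependl ?sn.
have pn h : prepend s h n = h 0%N by rewrite /prepend sn ltnn subnn.
have [Es|Es] := pselect (E (prepend s (fun=> 1%g))).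
  rewrite (_ : _ @^-1` E = setT) ?probability_setT ?mule1; last first.
    by apply/seteqP; split=> // h _; exact: pE Es.
  congr (Q _); apply/seteqP; split=> h /=; rewrite pn; first by case.
  by move=> Bh; split=> //; exact: pE Es.
rewrite (_ : _ @^-1` E = set0) ?measure0 ?mule0; last first.
  by apply/seteqP; split=> // h /pE.
rewrite (_ : _ @^-1` _ = set0) ?measure0//.
by apply/seteqP; split=> // h [/pE].
Qed.

(** An adapted involution maps the cylinder of a word onto the cylinder of
    another word of the same size, whose letters here have the same masses. *)
Lemma iid_involution_preserving (F : seq_space G -> seq_space G) :
  involutive F ->
  (forall n h h', mkseq h n = mkseq h' n -> mkseq (F h) n = mkseq (F h') n) ->
  (forall h t, m (F h t) = m (h t)) ->
  forall E, measurable E -> Q (F @^-1` E) = Q E.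
Proof.
move=> FK Fad mF.
have mf : measurable_fun setT F.
  apply: adapted_measurable => t; exists t.+1 => h h' /Fad.
  by move=> /(congr1 (nth 1%g ^~ t)); rewrite !nth_mkseq.
pose P1 : {measure set _ -> \bar R} := distribution Q (mfun_Sub (mem_set mf)).
apply: (@measure_eq_cyl _ _ P1 Q); rewrite /P1.
  rewrite /= /distribution /= /pushforward/= preimage_setT.
  by rewrite probability_setT ltry.
move=> s; rewrite /= /distribution/= /pushforward/=.
have cF h : cyl s h -> cyl (mkseq (F h) (size s)) `<=` F @^-1` (cyl s).
  move=> hs h'; rewrite /cyl/= size_mkseq => /Fad.
  by rewrite FK => ->.
rewrite (_ : _ @^-1` _ = cyl (mkseq (F (nth 1%g s)) (size s))); last first.
  have s1 : cyl s (nth 1%g s) by apply/cylP.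
  apply/seteqP; split; last exact: cF.
  move=> h /= hs; rewrite /cyl/= size_mkseq -(FK h); apply: Fad.
  by rewrite hs -[LHS]s1.
rewrite !iid_cyl; congr _%:E.
rewrite (big_nth 1%g) [in RHS](big_nth 1%g) size_mkseq.
by apply: eq_big_nat => t /andP[_ ts]; rewrite nth_mkseq.
Qed.

End IID.

(** * Existence of the law of the increments *)

Section UnitLebesgue.
Variable R : realType.

Definition unit_lebesgue : set (measurableTypeR R) -> \bar R :=
  mrestr lebesgue_measure (measurable_itv `[0, 1[ :
    measurable (`[0, 1[%classic : set (measurableTypeR R))).

HB.instance Definition _ := Measure.on unit_lebesgue.

Let unit_lebesgueT : unit_lebesgue setT = 1%E.
Proof.
rewrite /unit_lebesgue /mrestr setTI lebesgue_measure_itv/= lte_fin ltr01.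
by rewrite oppr0 adde0.
Qed.

HB.instance Definition _ :=
  Measure_isProbability.Build _ _ _ unit_lebesgue unit_lebesgueT.

End UnitLebesgue.

Section Kolmogorov.
Variables (G : countGroupType) (R : realType) (m : G -> R).
Hypothesis m_ge0 : forall x, 0 <= m x.
Hypothesis m_sum1 : (\esum_(x in [set: G]) (m x)%:E = 1)%E.
Implicit Types (s : seq G) (u : R).

(* The unit interval is cut into consecutive intervals [left x, left x + m x[,
   in the order of the codes of the elements; unused codes have weight 0. *)
Let weight k : R := oapp m 0 (@pickle_inv G k).
Let cum k : R := \sum_(j < k) weight j.
Let left (x : G) := cum (choice.pickle x).

Let weight_ge0 k : 0 <= weight k.
Proof. by rewrite /weight; case: pickle_inv => //= x; exact: m_ge0. Qed.

Let weight_pickle x : weight (choice.pickle x) = m x.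
Proof. by rewrite /weight pickleK_inv. Qed.

Let cumS k : cum k.+1 = cum k + weight k.
Proof. by rewrite /cum big_ord_recr. Qed.

Let le_cum j k : (j <= k)%N -> cum j <= cum k.
Proof.
elim: k => [|k IH]; first by rewrite leqn0 => /eqP ->.
rewrite leq_eqVlt => /orP[/eqP -> //|]; rewrite ltnS => /IH jk.
by rewrite cumS (le_trans jk)// lerDl.
Qed.

Let leftD x : left x + m x = cum (choice.pickle x).+1.
Proof. by rewrite cumS weight_pickle. Qed.

Let weight_sum1 : (\sum_(k <oo) (weight k)%:E = 1)%E.
Proof.
rewrite nneseries_esumT => [|k]; last by rewrite lee_fin.
rewrite -m_sum1 (esumID (range (@choice.pickle G))); last first.
  by move=> k _; rewrite lee_fin.
rewrite !setTI [X in (_ + X)%E]esum1 ?adde0; last first.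
  move=> k kG; rewrite /weight.
  case: (@pickle_inv G k) (@pickle_invK G k) => //= x xk.
  by exfalso; apply: kG; exists x.
rewrite (reindex_esum [set: G] _ choice.pickle).
  by apply: eq_esum => x _; rewrite weight_pickle.
by apply: inj_bij => x y _ _; exact: (pcan_inj choice.pickleK).
Qed.

Let cum_cover u : u < 1 -> exists k, u < cum k.
Proof.
move=> u1; apply: contrapT => /forallNP uc.
have : ((1 : \bar R) <= u%:E)%E; last by rewrite lee_fin leNgt u1.
rewrite -weight_sum1; apply: lime_le.
  by apply: is_cvg_nneseries => k _ _; rewrite lee_fin.
apply: nearW => k; rewrite big_mkord sumEFin lee_fin leNgt; apply/negP/uc.
Qed.

Let cum0 : cum 0 = 0. Proof. by rewrite /cum big_ord0. Qed.

Let cum_le1 k : cum k <= 1.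
Proof.
rewrite -lee_fin -weight_sum1 /cum -sumEFin -(big_mkord xpredT (EFin \o weight)).
by apply: nneseries_lim_ge => j _; rewrite lee_fin.
Qed.

(* [digit u] is the element whose interval contains [u], and [rest u] is the
   position of [u] in that interval, rescaled to the unit interval. *)
Let digit_at u : set G := [set x | left x <= u < left x + m x].
Let digit u : G := xget 1%g (digit_at u).
Let rest u : R := (u - left (digit u)) / m (digit u).

Let digit_at_uniq u x y : digit_at u x -> digit_at u y -> x = y.
Proof.
move=> /= /andP[x1 x2] /andP[y1 y2].
have [/le_cum| /le_cum|/(pcan_inj choice.pickleK) //] :=
    ltngtP (choice.pickle x) (choice.pickle y); rewrite -leftD => lt.
  by have := lt_le_trans x2 (le_trans lt y1); rewrite ltxx.
by have := lt_le_trans y2 (le_trans lt x1); rewrite ltxx.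
Qed.

Let digit_atP u : 0 <= u < 1 -> digit_at u (digit u).
Proof.
move=> /andP[u0 /cum_cover u1].
suff [x ux] : exists x, digit_at u x.
  by rewrite /digit; case: xgetP => [y _|/(_ x)].
case: (ex_minnP u1) => -[|k]; first by rewrite cum0 ltNge u0.
move=> uk kmin.
have ku : cum k <= u by rewrite leNgt; apply/negP => /kmin; rewrite ltnn.
move: uk; rewrite cumS /weight.
case: (@pickle_inv G k) (@pickle_invK G k) => /= [x xk|]; last first.
  by rewrite addr0 ltNge ku.
by move=> uk; exists x; rewrite /digit_at/= /left xk ku.
Qed.

Let digitE u x : 0 <= u < 1 -> (digit u = x <-> digit_at u x).
Proof.
move=> /digit_atP du; split => [<- //|ux]; exact: digit_at_uniq du ux.
Qed.

Let rest_unit u : 0 <= u < 1 -> 0 <= rest u < 1.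
Proof.
move=> /digit_atP/andP[d1 d2].
have m0 : 0 < m (digit u) by rewrite -(ltrDl (left (digit u))) (le_lt_trans d1).
by rewrite divr_ge0 ?subr_ge0//= ltr_pdivrMr// mul1r ltrBlDl.
Qed.

Let code u : seq_space G := fun t => digit (iter t rest u).

(* The left end of the interval of points whose expansion begins with [s]. *)
Let start s : R := foldr (fun x a => left x + m x * a) 0 s.

Let start_ge0 s : 0 <= start s.
Proof.
elim: s => //= x s IH; rewrite addr_ge0 ?mulr_ge0//.
by rewrite -cum0 le_cum.
Qed.

Let stop_le1 s : start s + \prod_(x <- s) m x <= 1.
Proof.
elim: s => [|x s IH]; first by rewrite big_nil add0r.
rewrite big_cons/= -addrA -mulrDr; apply: (@le_trans _ _ (left x + m x)).
  by rewrite lerD2l ler_piMr.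
by rewrite leftD.
Qed.

Let codeE s u : 0 <= u < 1 ->
  cyl s (code u) <-> start s <= u < start s + \prod_(x <- s) m x.
Proof.
elim: s u => [|x s IH] u u01; first by rewrite /= big_nil add0r; split.
have -> : cyl (x :: s) (code u) <-> digit u = x /\ cyl s (code (rest u)).
  split => [/cylP us|[ux /cylP us]].
    split; first exact: (us 0%N).
    by apply/cylP => t ts; rewrite -[RHS](us t.+1)// /code iterSr.
  by apply/cylP => -[_ //|t ts]; rewrite /code iterSr; exact: us.
rewrite IH ?rest_unit// big_cons/=; split.
  move=> [ux]; move: (digit_atP u01) => /andP[d1 d2].
  have m0 : 0 < m x by rewrite -ux -(ltrDl (left (digit u))) (le_lt_trans d1).
  rewrite /rest ux ler_pdivlMr// ltr_pdivrMr// lerBrDl ltrBlDl.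
  by rewrite mulrDl addrA [m x * start s]mulrC [m x * \prod_(_ <- _) _]mulrC.
move=> /andP[u1 u2].
have m0 : 0 < m x.
  rewrite lt0r m_ge0 andbT; apply/eqP => mx0.
  by move: (le_lt_trans u1 u2); rewrite mx0 !mul0r !addr0 ltxx.
have dx : digit u = x.
  apply/digitE => //=; apply/andP; split.
    by apply: le_trans u1; rewrite lerDl mulr_ge0.
  apply: (lt_le_trans u2); rewrite -addrA lerD2l -mulrDr.
  by rewrite ler_piMr.
split=> //; rewrite /rest dx ler_pdivlMr// ltr_pdivrMr// lerBrDl ltrBlDl.
by rewrite mulrDl addrA [_ * m x]mulrC u1 [_ * m x]mulrC u2.
Qed.

Let X u : seq_space G := if 0 <= u < 1 then code u else fun=> 1%g.

Let X_cyl s : X @^-1` cyl s `&` `[0, 1[ =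
  `[start s, start s + \prod_(x <- s) m x[%classic.
Proof.
apply/seteqP; split=> u /=; rewrite !in_itv/=.
  by move=> [+ u01]; rewrite /X u01 => /codeE -/(_ u01).
move=> us.
have u01 : 0 <= u < 1.
  have [u1 u2] := andP us.
  by rewrite (le_trans _ u1)//= (lt_le_trans u2).
by rewrite /X u01; split=> //; exact/codeE.
Qed.

Let mX : measurable_fun setT (X : measurableTypeR R -> seq_space G).
Proof.
apply: coordinatewise_measurable => t x.
rewrite -(setIT [set _ | _]) -(setUv `[0, 1[%classic) setIUr.
apply: measurableU.
  rewrite (_ : [set h | _] = X @^-1` [set h | h t = x])//.
  rewrite (@depends_on_first_cyl _ t.+1 [set h | h t = x]); last first.
    move=> h h' /(congr1 (fun s => nth 1%g s t)).
    by rewrite !nth_mkseq// => e /=; rewrite e.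
  rewrite preimage_bigcup setI_bigcupl.
  apply: bigcup_countType_measurable => s _.
  by rewrite X_cyl; exact: measurable_itv.
have [xe|xe] := eqVneq x 1%g.
  rewrite setIidr; first by apply: measurableC; exact: measurable_itv.
  by move=> u /=; rewrite in_itv/= /X => /negP/negbTE ->.
rewrite (_ : _ `&` _ = set0)//; apply/seteqP; split=> // u [/= Xu /negP].
rewrite in_itv/= => /negbTE u01; move: Xu; rewrite /X u01 => /esym/eqP.
by rewrite (negbTE xe).
Qed.

(** The points whose expansion starts with a given word form an interval of
    length the product of the masses of the letters. *)
Lemma iid_law_exists : exists Q : probability (seq_space G) R, iid_law m Q.
Proof.
exists (distribution (@unit_lebesgue R)
  (@mfun_Sub _ _ (measurableTypeR R) (seq_space G) X (mem_set mX))) => n x.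
rewrite /distribution/= /pushforward/=.
rewrite (_ : _ @^-1` _ = X @^-1` cyl (mkseq x n)); last first.
  apply/seteqP; split=> u /=.
    move=> ux; apply/cylP => t; rewrite size_mkseq => tn.
    by rewrite nth_mkseq// ux.
  by move/cylP => ux t tn; rewrite ux ?size_mkseq// nth_mkseq.
rewrite /unit_lebesgue /mrestr X_cyl lebesgue_measure_itv/= lte_fin ltrDl.
have -> : \prod_(y <- mkseq x n) m y = \prod_(t < n) m (x t).
  by rewrite /mkseq big_map -{1}(subn0 n) big_mkord.
case: ifPn => [_|]; first by rewrite -EFinB addrAC subrr add0r.
rewrite -leNgt => p0; congr _%:E; apply/eqP; rewrite eq_le p0 andbT.
by apply: prodr_ge0 => t _.
Qed.

End Kolmogorov.

(** * The increments of the walk *)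

Section Configurations.
Implicit Types (phi psi : config) (n : nat) (z : int).

Lemma config_plusE phi psi z : (phi + psi) z = phi z + psi z.
Proof. exact: config_addE. Qed.

Lemma F2_cases (a : 'F_2) : a = 0 \/ a = 1.
Proof. by case: a => [[|[|k]] //= ak]; [left|right]; exact: val_inj. Qed.

Lemma F2_addrr (a : 'F_2) : a + a = 0.
Proof. by have [->|->] := F2_cases a; exact: val_inj. Qed.

Lemma config_addrr phi : phi + phi = 0.
Proof.
by apply: configP => z; rewrite config_plusE F2_addrr; apply/esym/config0E.
Qed.

Lemma K_uniq n n' phi : K n phi -> K n' phi -> n = n'.
Proof.
move=> [sn en] [sn' en']; apply/eqP; rewrite eqn_leq -!lez_nat.
by have /andP[_ ->] := sn _ en'; have /andP[_ ->] := sn' _ en.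
Qed.

(** Coordinates on [K n]: the lamps 0, ..., n-1 are free and the lamp [n] is
    on, this being the default value outside ['I_n]. *)
Definition bits_config n (f : {ffun 'I_n -> 'F_2}) : config :=
  [fsfun z in [fset Posz k | k in iota 0 n.+1]%fset =>
    (if insub `|z|%N is Some i then f i else 1 : 'F_2) | 0].

Lemma bits_configE n (f : {ffun 'I_n -> 'F_2}) (i : 'I_n) :
  bits_config f (i : nat)%:Z = f i.
Proof.
rewrite fsfunE ifT; last first.
  apply/imfsetP; exists (i : nat) => //.
  by rewrite [_ \in _]mem_iota ltnS (ltnW (ltn_ord i)).
by rewrite absz_nat [insub _](valK i).
Qed.

Lemma K_bits_config n (f : {ffun 'I_n -> 'F_2}) : K n (bits_config f).
Proof.
split => [z|].
  rewrite fsfunE; case: ifPn => [/imfsetP[k]|_ /esym/eqP]; last first.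
    by rewrite oner_eq0.
  by rewrite [_ \in _]mem_iota ltnS => kn -> _; rewrite !lez_nat.
rewrite fsfunE ifT; last first.
  by apply/imfsetP; exists n => //; rewrite [_ \in _]mem_iota ltnS leqnn.
by rewrite /= insubF// ltnn.
Qed.

Lemma bits_config_inj n : injective (@bits_config n).
Proof.
by move=> f f' ff'; apply/ffunP => i; rewrite -!bits_configE ff'.
Qed.

Lemma K_out n phi z : K n phi -> ~~ (0 <= z <= n%:Z) -> phi z = 0.
Proof. by move=> [sn _] /negP zn; have [//|/sn] := F2_cases (phi z). Qed.

Lemma K_image n : K n = [set bits_config f | f in [set: {ffun 'I_n -> 'F_2}]].
Proof.
apply/seteqP; split=> [phi Kphi|_ [f _ <-]]; last exact: K_bits_config.
exists [ffun i : 'I_n => phi (i : nat)%:Z] => //.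
have Kf := K_bits_config [ffun i : 'I_n => phi (i : nat)%:Z].
apply: configP => z; have [zn|zn] := boolP (0 <= z <= n%:Z); last first.
  by rewrite (K_out Kf)// (K_out Kphi).
case: z zn => // k; rewrite lez_nat/= leq_eqVlt => /orP[/eqP ->|kn].
  by rewrite Kf.2 Kphi.2.
by rewrite (bits_configE _ (Ordinal kn)) ffunE.
Qed.

Lemma finite_K n : finite_set (K n).
Proof. by rewrite K_image; exact: finite_image. Qed.

Lemma card_K n : #|` fset_set (K n)| = (2 ^ n)%N.
Proof.
have -> : fset_set (K n) = [fset bits_config f | f : {ffun 'I_n -> 'F_2}]%fset.
  apply/fsetP => phi; rewrite in_fset_set ?K_image; last exact: finite_image.
  apply/idP/imfsetP => [|[f _ ->]]; first by rewrite inE => -[f _ <-]; exists f.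
  by rewrite inE; exists f.
rewrite card_imfset/=; last exact: bits_config_inj.
by rewrite -cardE card_ffun !card_ord.
Qed.

Lemma K_add n phi psi : K n phi ->
  (forall z, psi z = 1 -> 0 <= z < n%:Z) -> K n (phi + psi).
Proof.
move=> [sn en] psin; split=> [z|]; rewrite config_plusE.
  have [->|/sn//] := F2_cases (phi z); rewrite add0r => /psin/andP[-> /ltW].
  by move=> ->.
have [->|/psin] := F2_cases (psi n%:Z); first by rewrite addr0.
by rewrite ltxx andbF.
Qed.

End Configurations.

Section Measure.
Variables (R : realType) (alpha : nat -> R).
Hypothesis alpha_ge0 : forall n : nat, (1 <= n)%N -> 0 <= alpha n.
Implicit Types (phi psi : config) (n : nat) (g : lamplighter).

Definition layer n : set lamplighter := [set g | g.1 = -1 /\ K n g.2].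

Lemma trivIset_layer : trivIset setT layer.
Proof. by move=> n n' _ _ [g [[_ gn] [_ gn']]]; exact: K_uniq gn gn'. Qed.

Lemma kappaE n phi : K n phi -> kappa R n phi = 2 ^- n.
Proof.
by move=> nphi; rewrite /kappa /unif indicE mem_set// card_K natrX mul1r.
Qed.

Lemma kappa0 n phi : ~ K n phi -> kappa R n phi = 0.
Proof. by move=> nphi; rewrite /kappa /unif indicE memNset// mul0r. Qed.

Lemma lambdaE n phi : (1 <= n)%N -> K n phi ->
  lambda alpha phi = alpha n / 2 ^+ n.
Proof.
move=> n1 nphi; rewrite /lambda eseries_cond nneseries_esum; last first.
  by move=> k /andP[_ k1]; rewrite lee_fin mulr_ge0 ?alpha_ge0// divr_ge0.
rewrite (esumID [set n]); last first.
  by move=> k /andP[_ k1]; rewrite lee_fin mulr_ge0 ?alpha_ge0// divr_ge0.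
rewrite [X in (_ + X)%E]esum1 => [|k /= [_ kn]]; last first.
  rewrite kappa0 ?mulr0// => kphi; exact/kn/(K_uniq kphi nphi).
rewrite adde0 setIidr => [|_ -> //=].
by rewrite esum_set1 ?kappaE//= lee_fin mulr_ge0 ?alpha_ge0.
Qed.

Lemma lambda0 phi : (forall n, (1 <= n)%N -> ~ K n phi) -> lambda alpha phi = 0.
Proof.
move=> nphi; rewrite /lambda eseries0// => n n1 _.
by rewrite kappa0 ?mulr0//; exact: nphi.
Qed.

Lemma mu_layer n g : (1 <= n)%N -> layer n g -> mu alpha g = alpha n / 2 ^+ n.
Proof. by move=> n1 [g1 g2]; rewrite /mu g1 eqxx mul1r (lambdaE n1). Qed.

Lemma mu_out g : (forall n, (1 <= n)%N -> ~ layer n g) -> mu alpha g = 0.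
Proof.
move=> gn; rewrite /mu; have [g1|] := eqVneq g.1 (-1); last by rewrite mul0r.
by rewrite lambda0 ?mulr0// => n n1 ng; apply: (gn n n1).
Qed.

Lemma mu_ge0 g : 0 <= mu alpha g.
Proof.
have [[n [n1 ng]]|gn] := pselect (exists n, (1 <= n)%N /\ layer n g).
  by rewrite (mu_layer n1)// divr_ge0 ?alpha_ge0.
by rewrite mu_out// => n n1 ng; apply: gn; exists n.
Qed.

(** The layers are disjoint, and a layer has [2 ^ n] points on which [f] is
    constant: this reduces every sum over the group below to a series. *)
Lemma esum_layer (f : lamplighter -> \bar R) (c : nat -> R) :
  (forall n, (1 <= n)%N -> 0 <= c n) ->
  (forall n g, (1 <= n)%N -> layer n g -> f g = (c n)%:E) ->
  (forall g, (forall n, (1 <= n)%N -> ~ layer n g) -> f g = 0%E) ->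
  (\esum_(g in [set: lamplighter]) f g =
   \sum_(1 <= n <oo) (2 ^+ n * c n)%:E)%E.
Proof.
move=> c0 fc f0.
have f_ge0 g : (0 <= f g)%E.
  have [[n [n1 ng]]|gn] := pselect (exists n, (1 <= n)%N /\ layer n g).
    by rewrite (fc n)// lee_fin c0.
  by rewrite f0// => n n1 ng; apply: gn; exists n.
rewrite (esumID (\bigcup_(n in [set n | (1 <= n)%N]) layer n))// !setTI.
rewrite [X in (_ + X)%E]esum1 ?adde0; last first.
  by move=> g gn; apply: f0 => n n1 ng; apply: gn; exists n.
rewrite esum_bigcupT//; last exact: trivIset_layer.
rewrite eseries_cond nneseries_esum => [|n n1]; last first.
  by rewrite lee_fin mulr_ge0 ?c0.
apply: eq_esum => n /= n1.
rewrite (_ : layer n = (fun phi => (-1, phi) : lamplighter) @` K n); last first.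
  apply/seteqP; split=> [[z phi] [/= -> nphi]|_ [phi nphi <-]]; last by split.
  by exists phi.
rewrite esum_image; last by move=> phi psi _ _ [].
rewrite (eq_esum (b := fun=> (c n)%:E)); last first.
  by move=> phi nphi; exact: fc.
by rewrite esum_cst ?card_K ?natrX//; [exact: finite_K|exact: c0].
Qed.

End Measure.

(** * Entropy and mean length *)

Section Moments.
Variables (R : realType) (alpha : nat -> R).
Hypothesis alpha_ge0 : forall n : nat, (1 <= n)%N -> 0 <= alpha n.
Hypothesis alpha_sum1 : (\sum_(1 <= n <oo) (alpha n)%:E)%E = 1%E.
Implicit Types (n k t : nat) (g : lamplighter).

Lemma eseries1E (u : nat -> \bar R) :
  (\sum_(1 <= n <oo) u n = \sum_(n <oo | (1 <= n)%N) u n)%E.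
Proof. exact: eseries_cond. Qed.

Lemma eq_nneseries1 (u v : nat -> \bar R) :
  (forall n, (1 <= n)%N -> u n = v n) ->
  (\sum_(1 <= n <oo) u n = \sum_(1 <= n <oo) v n)%E.
Proof.
move=> uv; apply: congr_lim; apply/funext => k.
by apply: eq_big_nat => n /andP[/uv].
Qed.

Lemma le_nneseries1 (u v : nat -> \bar R) :
  (forall n, (1 <= n)%N -> 0 <= u n <= v n)%E ->
  (\sum_(1 <= n <oo) u n <= \sum_(1 <= n <oo) v n)%E.
Proof.
move=> uv; rewrite !eseries1E; apply: lee_nneseries => n.
  by move=> _ /uv/andP[].
by move=> /uv/andP[].
Qed.

Lemma alpha_le1 n : (1 <= n)%N -> alpha n <= 1.
Proof.
move=> n1; rewrite -lee_fin -alpha_sum1 eseries1E nneseries_esum => [|k k1].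
  apply: esum_ge; exists [set n]; first by split=> // _ ->.
  by rewrite fsbig_set1.
by rewrite lee_fin alpha_ge0.
Qed.

Lemma mu_sum1 : (\esum_(g in [set: lamplighter]) (mu alpha g)%:E = 1)%E.
Proof.
rewrite (@esum_layer _ _ (fun n => alpha n / 2 ^+ n)).
- rewrite -alpha_sum1; apply: eq_nneseries1 => n _.
  by rewrite mulrCA divff ?mulr1// expf_neq0.
- by move=> n n1; rewrite divr_ge0 ?alpha_ge0.
- by move=> n g n1 ng; rewrite (mu_layer _ n1).
- by move=> g gn; rewrite mu_out.
Qed.

Definition mean : \bar R := (\sum_(1 <= n <oo) (n%:R * alpha n)%:E)%E.

(** For [k = c + t], these are the increments which, made at time [t],
    randomize all the lamps from the current position [-t] up to [c - 1]. *)
Definition long k : set lamplighter :=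
  [set g | exists n, [/\ (1 <= n)%N, (k <= n)%N & layer n g]].

Lemma long_mass k : (\esum_(g in long k) (mu alpha g)%:E =
  \sum_(1 <= n <oo) ((k <= n)%:R * alpha n)%:E)%E.
Proof.
rewrite esum_mkcond (@esum_layer _ _ (fun n => (k <= n)%:R * alpha n / 2 ^+ n)).
- apply: eq_nneseries1 => n _.
  by rewrite mulrCA divff ?mulr1// expf_neq0.
- by move=> n n1; rewrite divr_ge0 ?mulr_ge0 ?alpha_ge0.
- move=> n g n1 ng; case: leqP => kn.
    by rewrite mem_set ?(mu_layer _ n1) ?mul1r//; exists n.
  rewrite memNset ?mul0r// => -[n' [_ kn' n'g]].
  have n'n := trivIset_layer Logic.I Logic.I (ex_intro _ g (conj n'g ng)).
  by move: kn'; rewrite n'n leqNgt kn.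
- by move=> g gn; rewrite mu_out//; case: ifP.
Qed.

(** A length [n] is counted once for each [t] with [k + t <= n], hence
    [n.+1 - k] times after exchanging the sums. *)
Lemma long_mass_sum k :
  (\sum_(t <oo) \esum_(g in long (k + t)) (mu alpha g)%:E =
  \sum_(1 <= n <oo) ((n.+1 - k)%N%:R * alpha n)%:E)%E.
Proof.
(* [alpha 0] may be negative; the factor with [alpha n] makes all terms of the
   double series nonnegative, as the exchange requires, and is 1 for positive
   [n] *)
rewrite (eq_eseriesr (g := fun t =>
    (\sum_(n <oo | (1 <= n)%N)
      ((k + t <= n)%N%:R * (0 <= alpha n)%R%:R * alpha n)%:E)%E)); last first.
  move=> t _; rewrite long_mass eseries1E.
  by apply: eq_eseriesr => n n1; rewrite alpha_ge0// mulr1.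
rewrite nneseries_interchange; last first.
  move=> t n; rewrite lee_fin -mulrA mulr_ge0//.
  by have [a0|] := leP 0 (alpha n); rewrite ?mul1r ?mul0r.
rewrite [RHS]eseries1E; apply: eq_eseriesr => n n1.
have a0 := alpha_ge0 n1.
rewrite nneseries_esumT => [|t]; last by rewrite lee_fin a0 mulr1 mulr_ge0.
rewrite (eq_esum (b := fun t =>
    if t \in `I_(n.+1 - k) then (alpha n)%:E else 0%E)).
  rewrite -esum_mkcond esum_cst//.
  by rewrite (@card_fset_set _ _ (n.+1 - k)).
move=> t _; rewrite a0 mulr1; case: ifPn => [/set_mem/=|/negP tn].
  by rewrite ltn_subRL ltnS => ->; rewrite mul1r.
rewrite leqNgt; case: ltnP; first by rewrite mul0r.
by move=> ktn; exfalso; apply: tn; apply/mem_set => /=; rewrite ltn_subRL ltnS.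
Qed.

Lemma infinite_mean_long k : mean = +oo%E ->
  (\sum_(t <oo) \esum_(g in long (k + t)) (mu alpha g)%:E = +oo)%E.
Proof.
move=> moo; rewrite long_mass_sum.
have : (mean <= \sum_(1 <= n <oo) ((n.+1 - k)%N%:R * alpha n)%:E + k%:R%:E)%E.
  rewrite -[X in (_ + X)%E]mule1 -alpha_sum1 !eseries1E.
  rewrite -nneseriesZl; last by move=> n n1; rewrite lee_fin alpha_ge0.
  rewrite -nneseriesD; last 2 first.
  - by move=> n _ n1; rewrite lee_fin mulr_ge0 ?alpha_ge0.
  - by move=> n _ n1; rewrite lee_fin mulr_ge0 ?alpha_ge0.
  rewrite /mean eseries1E; apply: lee_nneseries => n.
    by move=> _ n1; rewrite lee_fin mulr_ge0 ?alpha_ge0.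
  move=> n1; rewrite -EFinM -EFinD lee_fin -mulrDl ler_wpM2r ?alpha_ge0//.
  by rewrite -natrD ler_nat addnC -leq_subLR leq_sub2r.
rewrite moo => le; apply/eqP; apply: contraTT le => Sne.
by rewrite -ltNge lte_add_pinfty ?ltry// ltey.
Qed.

Lemma finite_mean_long : (mean < +oo)%E ->
  (\sum_(t <oo) \esum_(g in long t) (mu alpha g)%:E < +oo)%E.
Proof.
move=> moo; rewrite (long_mass_sum 0).
apply: (@le_lt_trans _ _ (mean + 1)%E); last by rewrite lte_add_pinfty// ltry.
rewrite -alpha_sum1 /mean !eseries1E.
rewrite -nneseriesD; last 2 first.
- by move=> n _ n1; rewrite lee_fin mulr_ge0 ?alpha_ge0.
- by move=> n _ n1; rewrite lee_fin alpha_ge0.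
apply: lee_nneseries => n.
  by move=> _ n1; rewrite lee_fin mulr_ge0 ?alpha_ge0.
by move=> n1; rewrite -EFinD lee_fin subn0 -natr1 mulrDl mul1r.
Qed.

Let nlogn (p : R) := - (p * ln p).

Let nlogn_ge0 n : (1 <= n)%N -> 0 <= nlogn (alpha n / 2 ^+ n).
Proof.
move=> n1; rewrite /nlogn oppr_ge0 mulr_ge0_le0 ?divr_ge0 ?alpha_ge0//.
rewrite ln_le0// ler_pdivrMr// ?exprn_gt0// mul1r.
by rewrite (le_trans (alpha_le1 n1))// exprn_ege1// ler1n.
Qed.

Lemma entropy_layers : entropy (mu alpha) =
  (\sum_(1 <= n <oo) (2 ^+ n * nlogn (alpha n / 2 ^+ n))%:E)%E.
Proof.
apply: esum_layer => [n n1|n g n1 ng|g gn]; first exact: nlogn_ge0.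
- by rewrite (mu_layer alpha_ge0 n1).
- by rewrite mu_out// mul0r oppr0.
Qed.

Let ln2_gt0 : 0 < ln (2 : R).
Proof. by rewrite ln_gt0// ltr1n. Qed.

Let scaled_nlogn n : 0 <= alpha n ->
  2 ^+ n * nlogn (alpha n / 2 ^+ n) =
  n%:R * (alpha n * ln 2) - alpha n * ln (alpha n).
Proof.
rewrite le0r => /orP[/eqP ->|a0].
  by rewrite /nlogn !mul0r !mulr0 oppr0 mulr0 addr0.
rewrite /nlogn ln_div ?posrE ?exprn_gt0// lnXn// -[ln 2 *+ n]mulr_natl.
by field; rewrite expf_neq0.
Qed.

(** Since [alpha n <= 1], the term [- alpha n * ln (alpha n)] can be dropped. *)
Lemma entropy_lower : ((ln 2)%:E * mean <= entropy (mu alpha))%E.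
Proof.
rewrite entropy_layers /mean eseries1E -nneseriesZl; last first.
  by move=> n n1; rewrite lee_fin mulr_ge0 ?alpha_ge0.
rewrite -eseries1E; apply: le_nneseries1 => n n1; have a0 := alpha_ge0 n1.
rewrite -EFinM !lee_fin mulr_ge0 ?mulr_ge0 ?(ltW ln2_gt0)//= scaled_nlogn//.
have : alpha n * ln (alpha n) <= 0 by rewrite mulr_ge0_le0// ln_le0// alpha_le1.
lra.
Qed.

(** From [ln x < x] at [x = 2 ^- n / alpha n] one gets
    [- alpha n * ln (alpha n) <= n * alpha n * ln 2 + 2 ^- n]. *)
Lemma entropy_upper : (entropy (mu alpha) <= (2 * ln 2)%:E * mean + 2%:E)%E.
Proof.
have geo : (\sum_(1 <= n <oo) (2 / (2 ^ n.+1)%:R)%:E <= (2%:E : \bar R))%E.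
  by rewrite eseries1E; exact: epsilon_trick0.
apply: le_trans (leeD2l _ geo).
rewrite entropy_layers /mean !eseries1E -nneseriesZl; last first.
  by move=> n n1; rewrite lee_fin mulr_ge0 ?alpha_ge0.
rewrite -nneseriesD; last 2 first.
- by move=> n _ n1; rewrite -EFinM lee_fin !mulr_ge0 ?alpha_ge0 ?(ltW ln2_gt0).
- by move=> n _ n1; rewrite lee_fin divr_ge0.
apply: lee_nneseries => [n _ n1|n n1]; rewrite ?lee_fin.
  by rewrite mulr_ge0 ?nlogn_ge0.
rewrite scaled_nlogn ?alpha_ge0//.
have -> : 2 / (2 ^ n.+1)%:R = 2 ^- n :> R.
  by rewrite expnS natrM natrX; field; rewrite expf_neq0.
have := alpha_ge0 n1; rewrite le0r => /orP[/eqP ->|a0].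
  by rewrite !(mulr0, mul0r) subr0 add0r invr_ge0 exprn_ge0.
have : ln (2 ^- n / alpha n) <= 2 ^- n / alpha n.
  by rewrite ltW// ln_sublinear// divr_gt0// invr_gt0 exprn_gt0.
rewrite ler_pdivlMr// ln_div ?posrE ?invr_gt0 ?exprn_gt0//.
rewrite lnV ?posrE ?exprn_gt0// lnXn// -[ln 2 *+ n]mulr_natl.
move=> le; rewrite -lerBlDl; apply: le_trans le.
rewrite le_eqVlt; apply/orP; left; apply/eqP; ring.
Qed.

Lemma entropy_infinite_mean : entropy (mu alpha) = +oo%E <-> mean = +oo%E.
Proof.
split=> oo.
  have := entropy_upper; rewrite oo => le; apply/eqP; apply: contraTT le => ne.
  rewrite -ltNge lte_add_pinfty ?ltry//.
  have : (mean < +oo)%E by rewrite ltey.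
  case: mean => [r| |] // _; first by rewrite -EFinM ltry.
  by rewrite mulrNy gtr0_sg ?mulr_gt0// mul1e.
have := entropy_lower; rewrite oo mulry gtr0_sg// mul1e leye_eq.
by move=> /eqP.
Qed.

End Moments.

(** * Modifying the first increment that hits a target *)

Section FirstHit.
Variables (G : countGroupType) (R : realType) (m : G -> R).
Variable Q : probability (seq_space G) R.
Hypothesis Qm : iid_law m Q.
(* [hit t] is the set of increments that can be modified at time [t]. It is
   stable under [mod t], so the modification does not move the first hit, and
   doing it twice does nothing. *)
Variables (hit : nat -> set G) (mod : nat -> G -> G).
Implicit Types (h : seq_space G) (t : nat).

Definition first_hit h t : bool :=
  (h t \in hit t) && all (fun u => h u \notin hit u) (iota 0 t).

Definition modify h : seq_space G :=
  fun t => if first_hit h t then mod t (h t) else h t.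

Hypothesis hit_mod : forall t x, hit t x -> hit t (mod t x).
Hypothesis modK : forall t x, hit t x -> mod t (mod t x) = x.
Hypothesis m_mod : forall t x, hit t x -> m (mod t x) = m x.

Let in_hit_modify h t : (modify h t \in hit t) = (h t \in hit t).
Proof.
rewrite /modify; case: ifPn => // /andP[/[dup] ht /set_mem/hit_mod/mem_set -> _].
by rewrite ht.
Qed.

Let first_hit_modify h t : first_hit (modify h) t = first_hit h t.
Proof.
rewrite /first_hit in_hit_modify; congr (_ && _).
by apply: eq_all => u; rewrite in_hit_modify.
Qed.

Let modifyK : involutive modify.
Proof.
move=> h; apply/funext => t.
transitivity (if first_hit (modify h) t then mod t (modify h t) else modify h t).
  by [].
rewrite first_hit_modify; case: ifPn => fh; rewrite /modify ?fh ?(negbTE fh)//.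
by apply: modK; have /andP[/set_mem] := fh.
Qed.

Let modify_adapted n h h' :
  mkseq h n = mkseq h' n -> mkseq (modify h) n = mkseq (modify h') n.
Proof.
move=> hh'; have e t : (t < n)%N -> h t = h' t.
  by move=> tn; have := congr1 (nth 1%g ^~ t) hh'; rewrite !nth_mkseq.
apply: (@eq_from_nth _ 1%g); rewrite !size_mkseq// => t tn.
rewrite !nth_mkseq// /modify /first_hit e//.
suff -> : all (fun u => h u \notin hit u) (iota 0 t) =
          all (fun u => h' u \notin hit u) (iota 0 t) by [].
by apply: eq_in_all => u; rewrite mem_iota/= => ut; rewrite e// (ltn_trans ut).
Qed.

Lemma modify_preserving E : measurable E -> Q (modify @^-1` E) = Q E.
Proof.
apply: (iid_involution_preserving Qm) => // h t.
by rewrite /modify; case: ifPn => // /andP[/set_mem/m_mod].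
Qed.

Lemma modify_measurable : measurable_fun setT modify.
Proof.
apply: adapted_measurable => t; exists t.+1 => h h' /modify_adapted.
by move=> /(congr1 (nth 1%g ^~ t)); rewrite !nth_mkseq.
Qed.

Lemma first_hit_exists h t : hit t (h t) -> exists i, first_hit h i.
Proof.
move=> ht; have ex : exists t, h t \in hit t by exists t; exact/mem_set.
case: (ex_minnP ex) => i hi imin; exists i; rewrite /first_hit hi/=.
apply/allP => u; rewrite mem_iota/= => ui; apply: contraL ui => /imin.
by rewrite -leqNgt.
Qed.

End FirstHit.

Section BorelCantelli.
Variables (G : countGroupType) (R : realType) (m : G -> R).
Variable Q : probability (seq_space G) R.
Hypothesis Qm : iid_law m Q.
Implicit Types (h : seq_space G) (t : nat).

Lemma iid_marginal n (B : set G) :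
  Q [set h | B (h n)] = (\esum_(x in B) (m x)%:E)%E.
Proof.
by rewrite -[X in Q X]setTI (iid_independent Qm)// probability_setT mul1e.
Qed.

Lemma iid_null_increment : Q [set h | exists t, m (h t) = 0] = 0%E.
Proof.
apply/eqP; rewrite eq_le measure_ge0 andbT.
rewrite (_ : [set h | _] = \bigcup_t [set h | [set x | m x = 0] (h t)]); last first.
  by apply/seteqP; split=> h [t]; [move=> ht; exists t|exists t].
apply: le_trans (generalized_Boole_inequality _ _ _) _.
- by move=> t; exact: measurable_coordinate_set.
- by apply: bigcupT_measurable => t; exact: measurable_coordinate_set.
rewrite eseries0// => t _ _; rewrite [LHS]iid_marginal esum1// => x /= ->.
by [].
Qed.

Variable hit : nat -> set G.

Let missed n : set (seq_space G) :=
  [set h | forall t, (t < n)%N -> ~ hit t (h t)].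

Let missed_dep n : depends_on_first n (missed n).
Proof.
move=> h h' hh' hn t tn; have := congr1 (nth 1%g ^~ t) hh'.
by rewrite !nth_mkseq// => <-; exact: hn.
Qed.

Let mass t : R := fine (Q [set h | hit t (h t)]).

Let massE t : (mass t)%:E = Q [set h | hit t (h t)].
Proof. by rewrite fineK// fin_num_measure//; exact: measurable_coordinate_set. Qed.

Let missedS n : Q (missed n.+1) = (Q (missed n) * (1 - mass n)%:E)%E.
Proof.
rewrite (_ : missed n.+1 = missed n `&` [set h | (~` hit n) (h n)]).
  rewrite (iid_independent Qm)//; congr (_ * _)%E.
  rewrite -(iid_marginal n) EFinB massE -[RHS]probability_setC//.
  exact: measurable_coordinate_set.
apply/seteqP; split=> h.
  by move=> hn; split=> [t tn|]; apply: hn => //; rewrite ltnW.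
move=> [hn hnn] t; rewrite ltnS leq_eqVlt => /orP[/eqP ->//|]; exact: hn.
Qed.

Let missed_le n : (Q (missed n) <= (expR (- \sum_(t < n) mass t))%:E)%E.
Proof.
elim: n => [|n IH].
  rewrite big_ord0 oppr0 expR0 probability_le1//.
  exact: depends_on_first_measurable.
rewrite missedS big_ord_recr/= opprD expRD EFinM.
apply: lee_pmul => //.
  rewrite lee_fin subr_ge0 -lee_fin massE; apply: probability_le1.
  exact: measurable_coordinate_set.
by rewrite lee_fin; exact: expR_ge1Dx.
Qed.

(** The probability of no hit before time [n] is the product of the [1 - p_t],
    at most [exp (- sum p_t)], where [p_t] is the mass of [hit t]. *)
Lemma iid_hit_ae : (\sum_(t <oo) \esum_(x in hit t) (m x)%:E = +oo)%E ->
  Q [set h : seq_space G | forall t, ~ hit t (h t)] = 0%E.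
Proof.
move=> hoo; set E : set (seq_space G) := [set h | _].
have mE : measurable E.
  rewrite (_ : E = \bigcap_n missed n).
    apply: bigcapT_measurable => n; exact: depends_on_first_measurable.
  apply/seteqP; split=> h hE; first by move=> n _ t _; exact: hE.
  by move=> t; exact: (hE t.+1).
have fE : Q E \is a fin_num by exact: fin_num_measure.
apply/eqP; rewrite eq_le measure_ge0 andbT leNgt; apply/negP => E0.
have e0 : 0 < fine (Q E) by rewrite -lte_fin fineK.
have : ((+oo : \bar R) <= (- ln (fine (Q E)))%:E)%E; last by rewrite leye_eq.
rewrite -hoo; apply: lime_le.
  by apply: is_cvg_nneseries => t _ _; rewrite -(iid_marginal t).
apply: nearW => n; rewrite (eq_bigr (fun t => (mass t)%:E)); last first.
  by move=> t _; rewrite massE iid_marginal.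
rewrite big_mkord sumEFin lee_fin lerNr -ler_expR lnK ?posrE// -lee_fin fineK//.
apply: le_trans (missed_le n); apply: le_measure; rewrite ?inE//.
  exact: depends_on_first_measurable.
by move=> h hE t _; exact: hE.
Qed.

End BorelCantelli.

(** * Invariant events of a random walk *)

Section Walk.
Variable G : countGroupType.
Implicit Types (h : seq_space G) (s : seq G) (A : set (seq_space G)).

Definition endpoint s : G := walk_at (nth 1%g s) (size s).

Lemma eq_walk_at h h' n : (forall t, (t < n)%N -> h t = h' t) ->
  walk_at h n = walk_at h' n.
Proof.
elim: n => //= n IH e; rewrite IH ?e// => t tn.
by rewrite e// ltnW.
Qed.

Lemma walk_measurable : measurable_fun setT (@walk G).
Proof.
apply: adapted_measurable => t; exists t => h h' hh'; apply: eq_walk_at => u ut.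
by have := congr1 (nth 1%g ^~ u) hh'; rewrite !nth_mkseq.
Qed.

Lemma walk_event_measurable A : measurable A -> measurable (@walk G @^-1` A).
Proof. by move=> mA; rewrite -[_ @^-1` _]setTI; exact: walk_measurable. Qed.

Lemma walk_prepend s h t :
  walk_at (prepend s h) (size s + t) = (endpoint s * walk_at h t)%g.
Proof.
elim: t => [|t IH].
  rewrite addn0 mulg1; apply: eq_walk_at => u us.
  by rewrite /prepend us.
by rewrite addnS/= IH /prepend ltnNge leq_addr/= addKn mulgA.
Qed.

Lemma shift_invariant A w n : @time_shift G @^-1` A = A ->
  A (fun t => w (n + t)%N) <-> A w.
Proof.
move=> AA; elim: n => [|n IH]; first by [].
rewrite -IH -{2}AA.
by rewrite /preimage/= /time_shift; split; congr (A _); apply/funext => t;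
  rewrite addSnnS.
Qed.

End Walk.

Section ZeroOne.
Variables (G : countGroupType) (R : realType) (m : G -> R).
Variable Q : probability (seq_space G) R.
Hypothesis Qm : iid_law m Q.
Implicit Types (s : seq G) (B : set (seq_space G)).

(** Independence of every cylinder extends to all events, in particular to [B]
    itself: [Q B = Q B ^ 2]. *)
Lemma zero_one_independent B : measurable B ->
  (forall s, Q (cyl s `&` B) = (Q B * Q (cyl s))%E) -> Q B = 0%E \/ Q B = 1%E.
Proof.
move=> mB Bcyl; have fB : Q B \is a fin_num by exact: fin_num_measure.
have B0 : 0 <= fine (Q B) by apply: fine_ge0; exact: measure_ge0.
pose P1 : {measure set (seq_space G) -> \bar R} := mrestr Q mB.
pose P2 : {measure set (seq_space G) -> \bar R} := mscale (NngNum B0) Q.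
have : P1 B = P2 B.
  apply: measure_eq_cyl => //.
    by rewrite /P1/= /mrestr setTI -ge0_fin_numE.
  by move=> s; rewrite /P1 /P2 /= /mrestr /mscale/= Bcyl fineK.
rewrite /P1 /P2 /= /mrestr /mscale/= setIid fineK// -(fineK fB) -EFinM.
move=> [/eqP]; rewrite -subr_eq0 -{1}[fine _]mulr1 -mulrBr mulf_eq0.
by move=> /orP[/eqP ->|]; [left|rewrite subr_eq0 => /eqP <-; right].
Qed.

(** By the Markov property the hypothesis says that the conditional probability
    of [B] given a prefix depends only on the size of the prefix; averaging
    over all prefixes of that size, it is [Q B]. *)
Lemma zero_one_futures B : measurable B ->
  (forall s s', size s = size s' ->
     \prod_(x <- s) m x != 0 -> \prod_(x <- s') m x != 0 ->
     Q (prepend s @^-1` B) = Q (prepend s' @^-1` B)) ->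
  Q B = 0%E \/ Q B = 1%E.
Proof.
move=> mB fut; apply: zero_one_independent => // s.
have mBs s' : measurable (B `&` cyl s').
  by apply: measurableI => //; exact: measurable_cyl.
have cross s' : size s' = size s ->
    (Q (B `&` cyl s) * Q (cyl s') = Q (cyl s) * Q (B `&` cyl s'))%E.
  move=> ss'; rewrite !(iid_markov Qm)// !(iid_cyl Qm).
  have [->|p] := eqVneq (\prod_(x <- s) m x) 0; first by rewrite !mul0e.
  have [->|p'] := eqVneq (\prod_(x <- s') m x) 0; first by rewrite !(mul0e,mule0).
  by rewrite (fut _ _ (esym ss'))// -muleA [(Q _ * _)%E]muleC.
have fBs : Q (B `&` cyl s) \is a fin_num by exact: fin_num_measure.
have fs : Q (cyl s) \is a fin_num.
  by apply: fin_num_measure; exact: measurable_cyl.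
rewrite setIC -[LHS]mule1 -(probability_setT Q) [RHS]muleC.
rewrite [X in (_ * X = _)%E](measure_partition_cyl Q (size s))//.
rewrite [X in (_ = _ * X)%E](measure_partition_cyl Q (size s) mB).
rewrite -(fineK fBs) -(fineK fs) -!esumZl; try by move=> *; exact: measure_ge0.
- by apply: eq_esum => s' ss'; rewrite !fineK// setTI cross.
- by apply: fine_ge0; exact: measure_ge0.
- by apply: fine_ge0; exact: measure_ge0.
Qed.

End ZeroOne.

(** * The walk on the lamplighter group *)

Section LamplighterWalk.
Variables (R : realType) (alpha : nat -> R).
Hypothesis alpha_ge0 : forall n : nat, (1 <= n)%N -> 0 <= alpha n.
Implicit Types (h : seq_space lamplighter) (x g : lamplighter) (t n c : nat).
Implicit Types (e phi : config) (z : int).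

Lemma shiftE n phi z : config_shift n phi z = phi (z - n%:Z).
Proof. exact: config_shiftE. Qed.

Lemma ll_mulE g x :
  (g * x)%g = (g.1 + x.1, g.2 + config_shift g.1 x.2) :> lamplighter.
Proof. by []. Qed.

Lemma ll_mul2E g x z : (g * x)%g.2 z = g.2 z + x.2 (z - g.1).
Proof. by rewrite config_addE config_shiftE. Qed.

Lemma mu_neq0_layer g : mu alpha g != 0 -> exists2 n, (1 <= n)%N & layer n g.
Proof.
move=> g0; apply: contrapT => gn; move/eqP: g0; apply.
by apply: mu_out => n n1 ng; apply: gn; exists n.
Qed.

Lemma walk_fst h t : (forall u, (u < t)%N -> (h u).1 = -1) ->
  (walk_at h t).1 = - t%:Z.
Proof.
elim: t => [|t IH] h1; first by rewrite oppr0.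
have -> : (walk_at h t.+1).1 = (walk_at h t).1 + (h t).1 by [].
rewrite IH ?h1// => [|u ut]; last by rewrite h1// ltnW.
lia.
Qed.

(** The increment is made at position [-t], so shifting [e] by [t] adds [e]
    itself to the final configuration. *)
Definition superpose e t x : lamplighter := (x.1, x.2 + config_shift t%:Z e).

Section Superpose.
Variables (e : config) (c : nat).
Hypothesis e_supp : forall z, e z = 1 -> 0 <= z < c%:Z.

Let layer_superpose n t x : (c + t <= n)%N -> layer n x ->
  layer n (superpose e t x).
Proof.
move=> ctn [x1 nx]; split=> //; apply: K_add => // z.
rewrite shiftE => /e_supp /andP[z0 zc]; apply/andP; split; first by lia.
lia.
Qed.

Let hit t := long (c + t).

Lemma hit_superpose t x : hit t x -> hit t (superpose e t x).
Proof.
by move=> [n [n1 ctn nx]]; exists n; split=> //; exact: layer_superpose.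
Qed.

Lemma superposeK t x : superpose e t (superpose e t x) = x.
Proof.
by case: x => z phi; rewrite /superpose/= -addrA config_addrr addr0.
Qed.

Lemma mu_superpose t x : hit t x -> mu alpha (superpose e t x) = mu alpha x.
Proof.
move=> [n [n1 ctn nx]]; rewrite !(mu_layer _ n1)//.
exact: layer_superpose.
Qed.

(** Later increments act by addition of translates that depend on the position
    only, so the added configuration is never altered. *)
Lemma walk_superpose h i t : (forall u, (h u).1 = -1) -> first_hit hit h i ->
  (i < t)%N ->
  walk_at (modify hit (superpose e) h) t =
  ((walk_at h t).1, (walk_at h t).2 + e).
Proof.
move=> h1 hi.
have late u : (i < u)%N -> modify hit (superpose e) h u = h u.
  move=> iu; rewrite /modify ifF//; apply: contraTF hi => /andP[_ /allP/(_ i)].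
  by rewrite mem_iota => /(_ iu) ni; rewrite /first_hit negb_and ni.
have early u : (u < i)%N -> modify hit (superpose e) h u = h u.
  move=> ui; rewrite /modify ifF//; apply: contraTF hi => /andP[hu _].
  rewrite /first_hit negb_and; apply/orP; right; apply/allPn; exists u.
    by rewrite mem_iota.
  by rewrite hu.
elim: t => // t IH; rewrite ltnS leq_eqVlt => /orP[/eqP <-|it] /=.
  rewrite (eq_walk_at early) {1}/modify hi.
  congr pair; apply: configP => z.
  rewrite !config_plusE !config_shiftE /superpose/= config_plusE shiftE.
  by rewrite walk_fst// opprK addrK addrA.
rewrite IH// late//; congr pair; apply: configP => z /=.
by rewrite !config_plusE !config_shiftE addrAC.
Qed.

End Superpose.
End LamplighterWalk.

(** * The zero-one law and its failure *)

Section TailEvents.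
Variables (R : realType) (alpha : nat -> R).
Hypothesis alpha_ge0 : forall n : nat, (1 <= n)%N -> 0 <= alpha n.
Hypothesis alpha_sum1 : (\sum_(1 <= n <oo) (alpha n)%:E)%E = 1%E.
Variable Q : probability (seq_space lamplighter) R.
Hypothesis Qmu : iid_law (mu alpha) Q.
Implicit Types (h : seq_space lamplighter) (x g : lamplighter) (t n c : nat).
Implicit Types (e phi : config) (z : int).

Definition null_step : set (seq_space lamplighter) :=
  [set h | exists t, mu alpha (h t) = 0].

Lemma null_step_measurable : measurable null_step.
Proof.
rewrite (_ : null_step = \bigcup_t [set h | [set x | mu alpha x = 0] (h t)]).
  by apply: bigcupT_measurable => t; exact: measurable_coordinate_set.
by apply/seteqP; split=> h [t]; [move=> ht; exists t|exists t].
Qed.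

Lemma off_null_step h : ~ null_step h ->
  forall u, exists2 n, (1 <= n)%N & layer n (h u).
Proof.
move=> hpos u; apply: (@mu_neq0_layer _ alpha).
by apply/eqP => hu; apply: hpos; exists u.
Qed.

Lemma config_bounded e : exists c, forall z, e z = 1 -> z < c%:Z.
Proof.
exists (\max_(z <- finsupp e) `|z|).+1 => z ez.
have ze : z \in finsupp e.
  by rewrite mem_finsupp ez; apply/eqP => /(congr1 val).
have : (`|z| <= \max_(z <- finsupp e) `|z|)%N.
  by rewrite (big_rem z ze)/= leq_maxl.
lia.
Qed.

Lemma walk_support h t : (forall u, (u < t)%N -> mu alpha (h u) != 0) ->
  forall z, (walk_at h t).2 z = 1 -> - t%:Z <= z.
Proof.
move=> hpos; have h1 u : (u < t)%N -> (h u).1 = -1.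
  by move=> /hpos/mu_neq0_layer[n _ []].
elim: t hpos h1 => [|t IH] hpos h1 z.
  by rewrite config0E => /(congr1 val).
rewrite ll_mul2E; have [->|wz] := F2_cases ((walk_at h t).2 z).
  rewrite add0r walk_fst => [|u ut]; last by rewrite h1// ltnW.
  have /mu_neq0_layer[n _ [_ [hn _]]] := hpos t (ltnSn t).
  by move=> /hn/andP[z0 _]; lia.
move=> _; suff : - t%:Z <= z by lia.
by apply: IH wz => u ut; [apply: hpos|apply: h1]; rewrite ltnW.
Qed.

Lemma word_pos (s : seq lamplighter) : \prod_(x <- s) mu alpha x != 0 ->
  forall u, (u < size s)%N -> mu alpha (nth 1%g s u) != 0.
Proof.
rewrite prodf_seq_neq0 => /allP sp u us.
by apply: (sp (nth 1%g s u)); rewrite mem_nth.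
Qed.

(** The difference of the endpoints, seen from the position [- size s], is a
    configuration [e] supported in [0, c[ for some [c]. The first increment at
    some time [t] of length at least [c + t] can absorb it. *)
Lemma equal_futures A (s s' : seq lamplighter) : mean alpha = +oo%E ->
  measurable A -> @time_shift _ @^-1` A = A -> size s = size s' ->
  \prod_(x <- s) mu alpha x != 0 -> \prod_(x <- s') mu alpha x != 0 ->
  Q (prepend s @^-1` (@walk _ @^-1` A)) =
  Q (prepend s' @^-1` (@walk _ @^-1` A)).
Proof.
move=> moo mA AA ss' /word_pos sp /word_pos s'p.
have endp1 (r : seq lamplighter) :
    (forall u, (u < size r)%N -> mu alpha (nth 1%g r u) != 0) ->
    (endpoint r).1 = - (size r)%:Z.
  by move=> rp; apply: walk_fst => u /rp/mu_neq0_layer[n _ []].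
(* addition is subtraction, lamps being valued in 'F_2 *)
pose e := config_shift (size s)%:Z ((endpoint s).2 + (endpoint s').2).
have e_ge0 z : e z = 1 -> 0 <= z.
  rewrite shiftE config_plusE => ez.
  suff : - (size s)%:Z <= z - (size s)%:Z by lia.
  have [e0|e1] := F2_cases ((endpoint s).2 (z - (size s)%:Z)); last first.
    exact: (walk_support sp).
  by rewrite e0 add0r ss' in ez; rewrite ss'; exact: (walk_support s'p).
have [c ec] := config_bounded e.
have e_supp z : e z = 1 -> 0 <= z < c%:Z by move=> /[dup] /e_ge0 -> /ec.
pose F := modify (fun t => long (c + t)) (superpose e).
pose B := @walk lamplighter @^-1` A.
have mB : measurable B by exact: walk_event_measurable.
have mp (r : seq lamplighter) : measurable (prepend r @^-1` B).
  by rewrite -[_ @^-1` _]setTI; exact: (@prepend_measurable lamplighter).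
rewrite -[RHS](modify_preserving Qmu (hit_superpose e_supp)
  (fun t x _ => superposeK e t x) (mu_superpose alpha_ge0 e_supp))//.
pose N := null_step `|` [set h | forall t, ~ long (c + t) (h t)].
have mN2 : measurable
    [set h : seq_space lamplighter | forall t, ~ long (c + t) (h t)].
  rewrite (_ : [set h | _] = \bigcap_t [set h | (~` long (c + t)) (h t)]).
    by apply: bigcapT_measurable => t; exact: measurable_coordinate_set.
  by apply/seteqP; split=> h hl t; [move=> _|]; exact: hl.
have mF : measurable_fun setT F.
  exact: modify_measurable.
apply: (@measure_eq_off_null _ _ _ Q N) => //.
- by apply: measurableU => //; exact: null_step_measurable.
- by rewrite -[_ @^-1` _]setTI; exact: mF.
- rewrite measureU0//; first exact: (iid_null_increment Qmu).
    exact: null_step_measurable.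
  exact: (iid_hit_ae Qmu (infinite_mean_long alpha_ge0 alpha_sum1 c moo)).
move=> h /not_orP[/off_null_step hlayer /existsNP[t0 /contrapT ht0]].
have h1 u : (h u).1 = -1 by have [n _ []] := hlayer u.
have [i hi] := @first_hit_exists _ (fun t => long (c + t)) h t0 ht0.
rewrite /preimage/= -/F.
(* compare the trajectories after the modified increment only *)
rewrite -(shift_invariant _ (size s + i.+1) AA).
rewrite -[X in _ <-> X](shift_invariant _ (size s + i.+1) AA).
suff -> : (fun t => walk (prepend s h) (size s + i.+1 + t)%N) =
          (fun t => walk (prepend s' (F h)) (size s + i.+1 + t)%N) by [].
apply/funext => t; rewrite /walk -!addnA walk_prepend ss' walk_prepend.
rewrite (walk_superpose _ h1 hi) ?leq_addr//.
move: (walk_at h (i.+1 + t)) => w.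
rewrite !ll_mulE/= !endp1// ss'; congr pair; apply: configP => z.
rewrite !(config_plusE, config_shiftE) -ss'.
by rewrite opprK addrK [in RHS]addrC -!addrA F2_addrr addr0 addrC.
Qed.

Lemma infinite_mean_zero_one A : mean alpha = +oo%E -> measurable A ->
  @time_shift _ @^-1` A = A ->
  pushforward Q (@walk _) A = 0%E \/ pushforward Q (@walk _) A = 1%E.
Proof.
move=> moo mA AA; apply: (zero_one_futures Qmu).
  exact: walk_event_measurable.
by move=> s s' ss' sp s'p; exact: equal_futures.
Qed.

Definition lamp_settles (b : 'F_2) : set (seq_space lamplighter) :=
  [set w : seq_space lamplighter |
    exists T, forall t, (T <= t)%N -> (w t : lamplighter).2 0 = b].

Lemma lamp_settles_measurable b : measurable (lamp_settles b).
Proof.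
rewrite (_ : lamp_settles b = \bigcup_T \bigcap_t
    [set w : seq_space lamplighter |
      [set x : lamplighter | (T <= t)%N -> x.2 0 = b] (w t)]).
  apply: bigcupT_measurable => T; apply: bigcapT_measurable => t.
  exact: measurable_coordinate_set.
apply/seteqP; split=> w [T].
  by move=> wT; exists T => // t _ /=; exact: wT.
by move=> _ wT; exists T => t Tt; exact: wT.
Qed.

Lemma lamp_settles_shift b :
  @time_shift _ @^-1` lamp_settles b = lamp_settles b.
Proof.
apply/seteqP; split=> w [T wT]; last first.
  by exists T => t Tt; rewrite /time_shift wT// leqW.
exists T.+1 => -[//|t] Tt; exact: (wT t).
Qed.

(** The increment at time [t] changes the lamp at 0 only if its length is at
    least [t], which happens finitely often when the mean is finite. *)
Lemma lamp_settles_ae : (mean alpha < +oo)%E ->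
  Q (@walk _ @^-1` (lamp_settles 0 `|` lamp_settles 1)) = 1%E.
Proof.
move=> mfin; rewrite -(probability_setT Q).
pose long_step t : set (seq_space lamplighter) := [set h | long t (h t)].
pose N := null_step `|` lim_sup_set long_step.
have mL t : measurable (long_step t) by exact: measurable_coordinate_set.
have mN2 : measurable (lim_sup_set long_step).
  by apply: bigcapT_measurable => n; exact: bigcup_measurable.
apply: (@measure_eq_off_null _ _ _ Q N) => //.
- by apply: measurableU => //; exact: null_step_measurable.
- by apply: walk_event_measurable; apply: measurableU;
    exact: lamp_settles_measurable.
- rewrite measureU0//; first exact: (iid_null_increment Qmu).
    exact: null_step_measurable.
  apply: lim_sup_set_cvg0 => //.
  rewrite (eq_eseriesr (g := fun t => \esum_(x in long t) (mu alpha x)%:E)%E).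
    exact: finite_mean_long.
  by move=> t _; exact: (iid_marginal Qmu).
move=> h /not_orP[/off_null_step hlayer hlim]; split=> // _.
have [T hT] : exists T, forall t, (T <= t)%N -> ~ long t (h t).
  apply: contrapT => /forallNP hT; apply: hlim => T _.
  have /existsNP[t /not_implyP[Tt /contrapT ht]] := hT T.
  by exists t.
have h1 u : (h u).1 = -1 by have [n _ []] := hlayer u.
have stable t : (walk h (T + t)%N).2 0 = (walk h T).2 0.
  elim: t => [|t IH]; first by rewrite addn0.
  rewrite -IH addnS [LHS]ll_mul2E [X in _ + X](_ : _ = 0) ?addr0//.
  have [n n1 hn] := hlayer (T + t)%N.
  apply: (K_out hn.2); rewrite walk_fst//.
  apply/negP => /andP[_ le]; apply: (hT (T + t)%N); first exact: leq_addr.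
  by exists n; split=> //; lia.
rewrite /preimage/=.
by have [w0|w1] := F2_cases ((walk h T).2 0); [left|right]; exists T => t Tt;
  rewrite -(subnKC Tt) stable.
Qed.

(** The first increment has length at least 1, so its lamp at 0 is uniform:
    here the first hit occurs at time 0 almost surely. *)
Lemma lamp_settles_flip :
  Q (@walk _ @^-1` lamp_settles 0) = Q (@walk _ @^-1` lamp_settles 1).
Proof.
have mX b : measurable (@walk _ @^-1` lamp_settles b).
  by apply: walk_event_measurable; exact: lamp_settles_measurable.
pose e := bits_config [ffun _ : 'I_0 => 0 : 'F_2].
have [e0 e1] : K 0 e := K_bits_config _.
have e_supp z : e z = 1 -> 0 <= z < 1%:Z by move=> /e0; lia.
rewrite -[RHS](modify_preserving Qmu (hit_superpose e_supp)
  (fun t x _ => superposeK e t x) (mu_superpose alpha_ge0 e_supp))//.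
apply: (@measure_eq_off_null _ _ _ Q null_step) => //.
- exact: null_step_measurable.
- by rewrite -[_ @^-1` _]setTI; apply: modify_measurable.
- exact: (iid_null_increment Qmu).
move=> h /off_null_step hlayer.
have h1 u : (h u).1 = -1 by have [n _ []] := hlayer u.
have h0 : first_hit (fun t => long (1 + t)) h 0.
  rewrite /first_hit/= andbT; apply/mem_set.
  by have [n n1 hn] := hlayer 0%N; exists n.
rewrite /preimage/= /lamp_settles/= /walk.
have flip t : (0 < t)%N ->
    (walk_at (modify (fun t => long (1 + t)) (superpose e) h) t).2 0 =
    (walk_at h t).2 0 + 1.
  by move=> t0; rewrite (walk_superpose _ h1 h0)//= config_plusE e1.
split=> -[T wT]; exists T.+1 => t Tt.
  by rewrite flip ?wT ?add0r// ?(leq_trans _ Tt)// ltnW.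
have := wT t (ltnW Tt); rewrite flip ?(leq_trans _ Tt)//.
by rewrite -[X in _ = X]add0r => /addIr.
Qed.

Lemma finite_mean_not_zero_one : (mean alpha < +oo)%E ->
  ~ (Q (@walk _ @^-1` lamp_settles 1) = 0%E \/
     Q (@walk _ @^-1` lamp_settles 1) = 1%E).
Proof.
move=> /lamp_settles_ae Q01.
have mX b : measurable (@walk _ @^-1` lamp_settles b).
  by apply: walk_event_measurable; exact: lamp_settles_measurable.
pose E := @walk _ @^-1` lamp_settles 1; rewrite -/E.
have Q1 : (Q E + Q E = 1)%E.
  rewrite -{1}lamp_settles_flip /E -Q01 preimage_setU measureU//.
  apply/seteqP; split=> // h [[T wT] [T' wT']].
  have := wT (maxn T T') (leq_maxl _ _); by rewrite wT' ?leq_maxr.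
case=> Qe; move: Q1; rewrite Qe.
  by rewrite adde0 => -[/esym/eqP]; rewrite oner_eq0.
by rewrite -EFinD => -[/eqP]; rewrite -subr_eq0 addrK oner_eq0.
Qed.

End TailEvents.

Theorem lemma47 (R : realType) (alpha : nat -> R)
  (alpha_ge0 : forall n : nat, (1 <= n)%N -> 0 <= alpha n)
  (alpha_sum1 : (\sum_(1 <= n <oo) (alpha n)%:E)%E = 1%E) :
  liouville (mu alpha) <-> entropy (mu alpha) = +oo%E.
Proof.
rewrite entropy_infinite_mean//; split=> [L|moo Q Qmu A mA AA].
  apply/eqP; rewrite -leye_eq leNgt; apply/negP => mfin.
  have [Q Qmu] :=
    iid_law_exists (mu_ge0 alpha_ge0) (mu_sum1 alpha_ge0 alpha_sum1).
  apply: (finite_mean_not_zero_one alpha_ge0 alpha_sum1 Qmu mfin).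
  apply: L => //; [exact: lamp_settles_measurable|exact: lamp_settles_shift].
exact: (infinite_mean_zero_one alpha_ge0 alpha_sum1 Qmu).
Qed.
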